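(* Let $\mathcal{A}$ be a unital zero product determined $*$-algebra with unit $I$ and let $\mathcal{M}$ be a unital $*$-$\mathcal{A}$-bimodule. Let $\delta$ and $\tau$ be linear mappings from $\mathcal{A}$ into $\mathcal{M}$. Then $\delta$ and $\tau$ satisfy $$A,B\in\mathcal{A},\ AB^*=0 \quad\Longrightarrow\quad \delta(A)B^*+A\tau(B)^*=0$$ if and only if there exist derivations $\Delta$ and $\Gamma$ from $\mathcal{A}$ into $\mathcal{M}$ such that $\delta(A)=\Delta(A)+\delta(I)A$, $\tau(A)=\Gamma(A)+\tau(I)A$, and $\Delta(A^* )=\Gamma(A)^*$ for each $A\in\mathcal{A}$.
   Context: Algebras are over the real or complex field. A $*$-$\mathcal{A}$-bimodule over a $*$-algebra $\mathcal{A}$ is an $\mathcal{A}$-bimodule $\mathcal{M}$ with a conjugate-linear map $M\mapsto M^*$ satisfying $M^{**}=M$, $(AM)^*=M^*A^*$, $(MA)^*=A^*M^*$ for $A\in\mathcal{A}$, $M\in\mathcal{M}$; it is unital if $IM=MI=M$. $\tau(B)^*$ means $(\tau(B))^*$. A linear mapping $\Delta:\mathcal{A}\to\mathcal{M}$ is a derivation if $\Delta(AB)=\Delta(A)B+A\Delta(B)$ for all $A,B\in\mathcal{A}$. An algebra $\mathcal{A}$ is zero product determined if for every linear space $\mathcal{X}$ and every bilinear mapping $\phi:\mathcal{A}\times\mathcal{A}\to\mathcal{X}$ satisfying $\phi(A,B)=0$ whenever $A,B\in\mathcal{A}$ and $AB=0$, there exists a linear mapping $\omega:\mathcal{A}\to\mathcal{X}$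 such that $\phi(A,B)=\omega(AB)$ for all $A,B\in\mathcal{A}$. *)

(* Defs.v *)
From HB Require Import structures.
From mathcomp Require Import all_boot all_order all_algebra.
From mathcomp Require Import reals complex.

Set Implicit Arguments.
Unset Strict Implicit.
Unset Printing Implicit Defensive.

Import GRing.Theory.
Local Open Scope ring_scope.

Variant scalar_kind := RealScalars | ComplexScalars.

Definition scalars (R : realType) (k : scalar_kind) : numFieldType :=
  match k with RealScalars => R | ComplexScalars => R[i] end.

Definition sconj (R : realType) (k : scalar_kind) : scalars R k -> scalars R k :=
  match k with RealScalars => id | ComplexScalars => @conjc R end.
Arguments sconj : clear implicits.

(* The map [conj] is the conjugation of the scalars. *)
HB.mixin Record isStarAlgebra (K : fieldType) (conj : K -> K) A
    of GRing.Algebra K A := {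
  star : A -> A;
  starD : {morph star : a b / a + b};
  starZ : forall (k : K) (a : A), star (k *: a) = conj k *: star a;
  starK : involutive star;
  starM : forall a b : A, star (a * b) = star b * star a
}.

#[short(type="starAlgType")]
HB.structure Definition StarAlgebra (K : fieldType) (conj : K -> K) :=
  {A of GRing.Algebra K A & isStarAlgebra K conj A}.

HB.mixin Record isBimodule (K : fieldType) (A : algType K) M
    of GRing.Lmodule K M := {
  lact : A -> M -> M;
  ract : M -> A -> M;
  lactDl : forall m, {morph lact^~ m : a b / a + b};
  lactDr : forall a, {morph lact a : m n / m + n};
  lactZl : forall (c : K) a m, lact (c *: a) m = c *: lact a m;
  lactZr : forall (c : K) a m, lact a (c *: m) = c *: lact a m;
  ractDl : forall a, {morph ract^~ a : m n / m + n};
  ractDr : forall m, {morph ract m : a b / a + b};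
  ractZl : forall (c : K) m a, ract (c *: m) a = c *: ract m a;
  ractZr : forall (c : K) m a, ract m (c *: a) = c *: ract m a;
  lactA : forall a b m, lact a (lact b m) = lact (a * b) m;
  ractA : forall m a b, ract (ract m a) b = ract m (a * b);
  lractA : forall a m b, ract (lact a m) b = lact a (ract m b)
}.

#[short(type="bimodType")]
HB.structure Definition Bimodule (K : fieldType) (A : algType K) :=
  {M of GRing.Lmodule K M & isBimodule K A M}.

Notation "a <*: m" := (lact a m) (at level 40, left associativity) : ring_scope.
Notation "m :*> a" := (ract m a) (at level 40, left associativity) : ring_scope.

HB.mixin Record isStarBimodule (K : fieldType) (conj : K -> K)
    (A : starAlgType conj) M of Bimodule K A M := {
  mstar : M -> M;
  mstarD : {morph mstar : m n / m + n};
  mstarZ : forall (k : K) (m : M), mstar (k *: m) = conj k *: mstar m;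
  mstarK : involutive mstar;
  mstar_lact : forall (a : A) (m : M), mstar (a <*: m) = mstar m :*> star a;
  mstar_ract : forall (m : M) (a : A), mstar (m :*> a) = star a <*: mstar m
}.

#[short(type="starBimodType")]
HB.structure Definition StarBimodule (K : fieldType) (conj : K -> K)
    (A : starAlgType conj) :=
  {M of Bimodule K A M & isStarBimodule K conj A M}.

Definition unital_bimodule (K : fieldType) (A : algType K) (M : bimodType A) :=
  forall m : M, (1 : A) <*: m = m /\ m :*> (1 : A) = m.

Definition derivation (K : fieldType) (A : algType K) (M : bimodType A)
    (D : {linear A -> M}) :=
  forall a b : A, D (a * b) = D a :*> b + a <*: D b.

Definition zero_product_determined (K : fieldType) (A : algType K) :=
  forall (X : lmodType K) (phi : {bilinear A -> A -> X}),
    (forall a b : A, a * b = 0 -> phi a b = 0) ->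
    exists omega : {linear A -> X}, forall a b : A, phi a b = omega (a * b).

(* Main.v *)
From HB Require Import structures.
Require Import Defs.
From mathcomp Require Import all_boot all_order all_algebra.
From mathcomp Require Import reals complex.

Import GRing.Theory.
Local Open Scope ring_scope.

(** The involution turns the hypothesis into one about ordinary zero products.
    Put [T b = tau(b^* )^*]; replacing [b] by [b^*], the hypothesis says that
    the bilinear map [phi(a, b) = delta(a) b + a T(b)] vanishes when [a b = 0].
    Since the algebra is zero product determined, [phi(a, b)] depends only on
    [a b], so [phi(a, b) = phi(a b, 1)], that is
      [delta(a) b + a T(b) = delta(a b) + a b T(1)].
    Taking [a = 1] expresses [T] through [delta]; substituting this back leaves
    exactly the Leibniz rule for [Delta(a) = delta(a) - delta(1) a], together
    with [T(b) = Delta(b) + b T(1)] (lemma [zero_product_derivation]).  Applying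
    the involution to the latter gives [Delta(a^* ) = Gamma(a)^*] for
    [Gamma(a) = tau(a) - tau(1) a], and the Leibniz rule passes from [Delta] to
    [Gamma] because the involution reverses products.

    Conversely, if [Delta] is a derivation, [delta(a) = Delta(a) + s a] and
    [T(b) = Delta(b) + b t], then [delta(a) b + a T(b)] is visibly a function of
    [a b] that vanishes at [0] (lemma [twisted_leibniz]). *)

Lemma ract_linear {K : fieldType} {A : algType K} {M : bimodType A} (m : M) :
  linear (fun a : A => m :*> a).
Proof. by move=> c a b; rewrite ractDr ractZr. Qed.

Lemma lact0l {K : fieldType} {A : algType K} {M : bimodType A} (m : M) :
  (0 : A) <*: m = 0.
Proof. by rewrite -(scale0r (0 : A)) lactZl scale0r. Qed.

Lemma ract0r {K : fieldType} {A : algType K} {M : bimodType A} (m : M) :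
  m :*> (0 : A) = 0.
Proof. by rewrite -(scale0r (0 : A)) ractZr scale0r. Qed.

Definition sub_unit_value {K : fieldType} {A : algType K} {M : bimodType A}
  (f : {linear A -> M}) (a : A) : M := f a - f 1 :*> a.

Lemma sub_unit_value_linear {K : fieldType} {A : algType K} {M : bimodType A}
  (f : {linear A -> M}) : linear (sub_unit_value f).
Proof.
move=> c a b; rewrite /sub_unit_value linearP ract_linear.
by rewrite scalerBr opprD addrACA.
Qed.

HB.instance Definition _ (K : fieldType) (A : algType K) (M : bimodType A)
    (f : {linear A -> M}) :=
  GRing.isLinear.Build K A M *:%R (sub_unit_value f) (sub_unit_value_linear f).

Lemma sub_unit_valueK {K : fieldType} {A : algType K} {M : bimodType A}
  (f : {linear A -> M}) (a : A) : f a = sub_unit_value f a + f 1 :*> a.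
Proof. by rewrite subrK. Qed.

Lemma leibniz_pairing_bilinear {K : fieldType} {A : algType K}
    {M : bimodType A} (f g : {linear A -> M}) :
  bilinear_for *:%R *:%R (fun a b : A => f a :*> b + a <*: g b).
Proof.
split=> [b c a a' | a c b b'] /=.
  by rewrite linearP ractDl ractZl lactDl lactZl scalerDr addrACA.
by rewrite linearP ractDr ractZr lactDr lactZr scalerDr addrACA.
Qed.

(** A bilinear map factoring through the product is determined by its values
    at pairs [(a b, 1)]. *)
Lemma leibniz_pairing_eq {K : fieldType} {A : algType K} {M : bimodType A}
    (A_zpd : zero_product_determined A) (M_unital : unital_bimodule M)
    (f g : {linear A -> M}) :
    (forall a b : A, a * b = 0 -> f a :*> b + a <*: g b = 0) ->
  forall a b : A, f a :*> b + a <*: g b = f (a * b) + (a * b) <*: g 1.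
Proof.
pose phi := fun a b : A => f a :*> b + a <*: g b.
pose phiB : {bilinear A -> A -> M} :=
  HB.pack phi (bilinear_isBilinear.Build K A A M *:%R *:%R phi
                 (leibniz_pairing_bilinear f g)).
move=> phi0; have [omega phiE] := A_zpd M phiB phi0.
move=> a b; rewrite -[LHS]/(phiB a b) phiE.
by rewrite -[X in omega X]mulr1 -phiE /= /phi (M_unital _).2.
Qed.

(** The pairing identity at [a = 1] gives [g] in terms of [f]; put back into
    the identity, the terms [a b g(1)] and [f(1) a b] cancel, and what is left
    is the Leibniz rule. *)
Lemma zero_product_derivation {K : fieldType} {A : algType K}
    {M : bimodType A} (A_zpd : zero_product_determined A)
    (M_unital : unital_bimodule M) (f g : {linear A -> M}) :
    (forall a b : A, a * b = 0 -> f a :*> b + a <*: g b = 0) ->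
  derivation (sub_unit_value f) /\
  forall b : A, g b = sub_unit_value f b + b <*: g 1.
Proof.
move=> fg0; have fgE := leibniz_pairing_eq A_zpd M_unital f g fg0.
have gE b : g b = sub_unit_value f b + b <*: g 1.
  apply: (addrI (f 1 :*> b)); rewrite -[in LHS](M_unital (g b)).1 fgE mul1r.
  by rewrite (sub_unit_valueK f b) addrCA addrA.
split=> // a b; have := fgE a b.
rewrite gE lactDr lactA addrA => /addIr.
rewrite (sub_unit_valueK f a) (sub_unit_valueK f (a * b)).
by rewrite ractDl ractA addrAC => /addIr.
Qed.

Lemma twisted_leibniz {K : fieldType} {A : algType K} {M : bimodType A}
    (D : {linear A -> M}) (s t : M) : derivation D ->
  forall a b : A, (D a + s :*> a) :*> b + a <*: (D b + b <*: t) =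
    D (a * b) + s :*> (a * b) + (a * b) <*: t.
Proof.
by move=> DM a b; rewrite ractDl ractA lactDr lactA addrA DM (addrAC (_ :*> b)).
Qed.

Lemma star1 {K : fieldType} {conj : K -> K} {A : starAlgType conj} :
  star (1 : A) = 1.
Proof. by rewrite -[RHS]starK -[in RHS](mulr1 (star 1)) starM starK mulr1. Qed.

(** Conjugating by the involutions is conjugate-linear twice, so it preserves
    linearity. *)
Lemma star_conjugate_linear {K : fieldType} {conj : K -> K}
    (conjK : involutive conj) {A : starAlgType conj} {M : starBimodType A}
    (f : {linear A -> M}) : linear (fun a : A => mstar (f (star a))).
Proof. by move=> c a b; rewrite starD starZ linearP mstarD mstarZ conjK. Qed.

(** Both the algebra and the bimodule involution reverse products, so the two
    terms of the Leibniz rule for [D] are exchanged into those for [G]. *)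
Lemma derivation_star_conjugate {K : fieldType} {conj : K -> K}
    {A : starAlgType conj} {M : starBimodType A} (D G : {linear A -> M}) :
    (forall a : A, D (star a) = mstar (G a)) -> derivation D -> derivation G.
Proof.
move=> DG DM a b; apply: (can_inj mstarK).
by rewrite -DG starM DM mstarD mstar_ract mstar_lact -!DG addrC.
Qed.

Lemma sconjK (R : realType) (k : scalar_kind) : involutive (sconj R k).
Proof. by case: k => //=; exact: conjcK. Qed.

Theorem theorem4p1 (R : realType) (k : scalar_kind)
    (A : starAlgType (sconj R k)) (M : starBimodType A)
    (A_zpd : zero_product_determined A) (M_unital : unital_bimodule M)
    (delta tau : {linear A -> M}) :
  (forall a b : A, a * star b = 0 ->
     delta a :*> star b + a <*: mstar (tau b) = 0) <->
  (exists Delta Gamma : {linear A -> M},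
     [/\ derivation Delta, derivation Gamma &
       forall a : A,
         [/\ delta a = Delta a + delta 1 :*> a,
             tau a = Gamma a + tau 1 :*> a &
             Delta (star a) = mstar (Gamma a)]]).
Proof.
split=> [dt0 | [Delta [Gamma [DeltaM _ dtE]]] a b ab0].
  pose T := fun b : A => mstar (tau (star b)).
  pose TL : {linear A -> M} :=
    HB.pack T (GRing.isLinear.Build _ A M *:%R T
                 (star_conjugate_linear (@sconjK R k) tau)).
  have dT0 (a b : A) : a * b = 0 -> delta a :*> b + a <*: TL b = 0.
    by move=> ab0; have := dt0 a (star b); rewrite starK; exact.
  have [DeltaM TE] := zero_product_derivation A_zpd M_unital delta TL dT0.
  have DeltaGamma (a : A) :
      sub_unit_value delta (star a) = mstar (sub_unit_value tau a).
    have := TE (star a); rewrite /= /T starK star1 (sub_unit_valueK tau a).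
    by rewrite mstarD mstar_ract => /addIr.
  exists (sub_unit_value delta), (sub_unit_value tau); split=> //.
    exact: derivation_star_conjugate DeltaGamma DeltaM.
  by move=> a; split; rewrite -?sub_unit_valueK -?DeltaGamma.
have [deltaE _ _] := dtE a; have [_ tauE DG] := dtE b.
rewrite deltaE tauE mstarD mstar_ract -DG (twisted_leibniz _ _ _ DeltaM).
by rewrite ab0 linear0 ract0r lact0l !addr0.
Qed.
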